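(* Let $G=A_5\times\mathbb{Z}_{16}$ and $A=\mathbb{Z}_{15}\times\mathbb{Z}_2^2\times\mathbb{Z}_4^2$. Then $|G|=|A|=960$ and $\alpha(G)=\alpha(A)=\frac{1}{6}$, but $G$ is not solvable. Consequently, it is not true that for every finite abelian group $A$ and every finite group $G$ with $|G|=|A|$ and $\alpha(G)=\alpha(A)$, the group $G$ is solvable.
   Context: For a finite group $G$, $c(G)$ is the number of cyclic subgroups of $G$ (including the trivial subgroup), and $\alpha(G)=\frac{c(G)}{|G|}$. $\mathbb{Z}_n$ is the cyclic group of order $n$, and $A_5$ is the alternating group on $5$ letters. *)

(* Defs.v *)
From mathcomp Require Import all_boot all_order all_algebra all_fingroup all_solvable.

Set Implicit Arguments.
Unset Strict Implicit.
Unset Printing Implicit Defensive.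

Import GRing.Theory.
Local Open Scope group_scope.

Definition num_cyclic (gT : finGroupType) (G : {group gT}) : nat :=
  #|[set H : {group gT} | (H \subset G) && cyclic H]|.

Definition alpha (gT : finGroupType) (G : {group gT}) : rat :=
  ((num_cyclic G)%:R / #|G|%:R)%R.

(* 'Z_n (for n > 1) carries its additive group structure as a finGroupType, and
   a product of finGroupTypes carries the componentwise one, so setX is the
   external direct product of groups. *)
Definition A5_x_Z16 : {group {perm 'I_5} * 'Z_16} :=
  setX_group 'Alt_('I_5)%G [set: 'Z_16]%G.

Definition Z15_x_Z2Z2_x_Z4Z4 :
    {group 'Z_15 * (('Z_2 * 'Z_2) * ('Z_4 * 'Z_4))} :=
  [set: 'Z_15 * (('Z_2 * 'Z_2) * ('Z_4 * 'Z_4))]%G.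

(* Main.v *)
Require Import Defs.
From mathcomp Require Import all_boot all_order all_algebra all_fingroup all_solvable.

Local Open Scope group_scope.

(** A cyclic subgroup of order [d] has [totient d] generators, so the number of
    cyclic subgroups is a function of the multiset of element orders alone.  That
    multiset is explicit for [Z_n], is obtained by taking lcm's for a direct
    product, and is found for [A_5] by enumeration, since [A_5] is exactly the
    set of squares of [S_5]. *)

Definition orders {gT : finGroupType} (A : {set gT}) : seq nat :=
  [seq #[x] | x <- enum A].

Definition cyclic_count (s : seq nat) : nat :=
  sumn [seq count_mem d s %/ totient d | d <- undup s].

Lemma perm_cyclic_count s t : perm_eq s t -> cyclic_count s = cyclic_count t.
Proof.
move=> st; rewrite /cyclic_count.
rewrite (eq_map (g := fun d => count_mem d t %/ totient d)); last first.
  by move=> d; rewrite (seq.permP st).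
exact/perm_sumn/perm_map/perm_undup/perm_mem.
Qed.

(** Elements of order [d] are sorted by the subgroup they generate; each cyclic [H] of order [d]
    receives exactly its [totient d] generators. *)
Lemma count_orders (gT : finGroupType) (G : {group gT}) d :
  count_mem d (orders G)
    = (#|[set H : {group gT} | [&& H \subset G, cyclic H & #|H| == d]]|
       * totient d)%N.
Proof.
set S := [set H | _].
rewrite count_map -sum1_count big_enum_cond /=.
rewrite (partition_big (@cycle_group gT) (mem S)) /=; last first.
  by move=> x /andP[Gx ox]; rewrite inE cycle_subG Gx cycle_cyclic.
rewrite -sum_nat_const; apply: eq_bigr => H.
rewrite inE => /and3P[sHG /cyclicP[a defH] /eqP <-].
rewrite defH -orderE totient_gen -sum1_card; apply: eq_bigl => x.
rewrite inE /generator -val_eqE /= defH eq_sym.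
(* A generator of [<[a]>] lies in [G] and has the order of [a], so the fibre over [H] consists of
   all generators of [H]. *)
have [eq_ax|_] := eqVneq <[x]> <[a]>; last by rewrite andbF.
by rewrite -cycle_subG eq_ax -defH sHG !orderE eq_ax eqxx.
Qed.

Lemma num_cyclic_orders (gT : finGroupType) (G : {group gT}) :
  num_cyclic G = cyclic_count (orders G).
Proof.
pose P := [pred H : {group gT} | (H \subset G) && cyclic H].
(* Each inner sum is 1: the order of [H] is that of a generator, hence listed, and [undup] keeps it
   once. Exchanging the sums then groups the subgroups by order. *)
transitivity (\sum_(H | P H) \sum_(d <- undup (orders G) | d == #|H|) 1).
  rewrite /num_cyclic -sum1_card; apply: eq_big => [H | H]; first by rewrite !inE.
  rewrite inE => /andP[sHG /cyclicP[a defH]].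
  have oa: #|H| \in orders G.
    by rewrite defH; apply: map_f; rewrite mem_enum -cycle_subG -defH.
  by rewrite sum1_count count_uniq_mem ?undup_uniq // mem_undup oa.
rewrite (exchange_big_dep xpredT) //= /cyclic_count sumnE big_map.
rewrite [LHS]big_seq [RHS]big_seq; apply: eq_bigr => d.
rewrite mem_undup => /mapP[x _ ->].
rewrite count_orders mulnK ?totient_gt0 ?order_gt0 // sum1dep_card.
by apply: eq_card => H; rewrite !inE eq_sym andbA.
Qed.

Lemma order_pair (gT hT : finGroupType) (x : gT) (y : hT) :
  #[(x, y)] = lcmn #[x] #[y].
Proof.
have expp n : (x, y) ^+ n = (x ^+ n, y ^+ n).
  by elim: n => // n IHn; rewrite !expgS IHn.
apply/eqP; rewrite eqn_dvd order_dvdn expp dvdn_lcm !order_dvdn.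
rewrite -[1 in X in X && _]/(1, 1) xpair_eqE -!order_dvdn dvdn_lcml dvdn_lcmr /=.
rewrite !order_dvdn -xpair_eqE -expp; exact/eqP/expg_order.
Qed.

Lemma orders_setX (gT hT : finGroupType) (A : {set gT}) (B : {set hT}) s t :
  perm_eq (orders A) s -> perm_eq (orders B) t ->
  perm_eq (orders (setX A B)) [seq lcmn m n | m <- s, n <- t].
Proof.
move=> As Bt; pose ord2 (u : gT * hT) := lcmn #[u.1] #[u.2].
(* The literal order lists come first; [s] and [t] replace them afterwards by comparing counts. *)
have /perm_trans -> //: perm_eq (orders (setX A B))
    [seq lcmn m n | m <- orders A, n <- orders B].
  rewrite allpairs_mapl allpairs_mapr -(map_allpairs ord2 pair).
  rewrite /orders (eq_map (g := ord2)); last by case=> x y; rewrite order_pair.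
  apply/perm_map/uniq_perm; first exact: enum_uniq.
    by rewrite allpairs_uniq ?enum_uniq // => -[x y] [x' y'].
  case=> x y; rewrite mem_enum inE /=; apply/andP/allpairsP => [[Ax By] | ].
    by exists (x, y); rewrite !mem_enum.
  by case=> -[x' y'] /=; rewrite !mem_enum => -[? ? [-> ->]].
apply/seq.permP => a; rewrite -!sum1_count !(big_mkcond a) !big_allpairs_dep /=.
by rewrite (perm_big s) //; apply: eq_bigr => m _; apply: perm_big.
Qed.

(** The element [i] is the [i]-th power of the generator [Zp1], whose order is [n.+1]. *)
Lemma orders_Zp n :
  orders [set: 'I_n.+1] = [seq n.+1 %/ gcdn n.+1 i | i <- iota 0 n.+1].
Proof.
rewrite /orders -val_enum_ord -map_comp enum_setT -enumT.
by apply: eq_map => i; rewrite /= -[i in LHS]Zp1_expgz orderXgcd order_Zp1.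
Qed.

(* ['S_n] does not reduce under [vm_compute]; lists of values make the enumeration
   of [S_5] computable. *)

Definition perm_code {n} (x : 'S_n) : seq nat := [seq val (x i) | i <- enum 'I_n].

(** Permutations multiply from left to right, so [t] is read at the entries of [s]. *)
Definition code_mul (s t : seq nat) : seq nat := [seq nth 0 t i | i <- s].

(** Index [k] stands for the power [k.+1], hence the final successor. On codes the range suffices,
    since an element's order is at most that of the symmetric group. *)
Definition code_order (s : seq nat) : nat :=
  let n := size s in
  (find (fun k => iter k (code_mul s) s == iota 0 n) (iota 0 n`!)).+1.

Lemma size_perm_code n (x : 'S_n) : size (perm_code x) = n.
Proof. by rewrite size_map size_enum_ord. Qed.

Lemma nth_perm_code n (x : 'S_n) (i : 'I_n) : nth 0 (perm_code x) i = x i.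
Proof. by rewrite (nth_map i) ?size_enum_ord ?nth_ord_enum. Qed.

Lemma perm_code_inj n : injective (@perm_code n).
Proof.
move=> x y eq_xy; apply/permP => i; apply: val_inj.
by rewrite /= -!nth_perm_code eq_xy.
Qed.

Lemma perm_code1 n : perm_code (1 : 'S_n) = iota 0 n.
Proof. by rewrite -val_enum_ord; apply: eq_map => i; rewrite perm1. Qed.

Lemma perm_codeM n (x y : 'S_n) :
  perm_code (x * y) = code_mul (perm_code x) (perm_code y).
Proof.
rewrite /code_mul -map_comp; apply: eq_map => i /=.
by rewrite nth_perm_code permM.
Qed.

Lemma perm_codeX n (x : 'S_n) k :
  perm_code (x ^+ k.+1) = iter k (code_mul (perm_code x)) (perm_code x).
Proof. by elim: k => // k IHk; rewrite expgS perm_codeM IHk. Qed.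

Lemma order_perm_code n (x : 'S_n) : #[x] = code_order (perm_code x).
Proof.
have ox_le : #[x] <= n`!.
  have cardS : #|[set: 'S_n]| = n`! by rewrite cardsT card_Sn.
  by rewrite -cardS dvdn_leq ?cardG_gt0 ?order_dvdG ?inE.
rewrite /code_order size_perm_code.
have [k def_ox] : {k | #[x] = k.+1} by exists #[x].-1; rewrite prednK ?order_gt0.
rewrite def_ox in ox_le *; congr _.+1.
rewrite (eq_find (a2 := fun k => #[x] %| k.+1)); last first.
  move=> j; rewrite -perm_codeX -(perm_code1 n) (inj_eq (@perm_code_inj n)).
  by rewrite order_dvdn.
(* The range is cut at [k]: below it [j.+1] is smaller than the order [k.+1], so nothing is found,
   and the second piece succeeds at its head. *)
rewrite -(subnKC ox_le) addSn -addnS iotaD find_cat.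
rewrite (_ : has _ _ = false) ?size_iota /= ?def_ox ?dvdnn ?addn0 //.
apply/hasPn => j; rewrite mem_iota /= => lt_jk.
by rewrite gtnNdvd.
Qed.

(** Surjectivity by counting: [perm_code] maps the [n!] permutations injectively into a list of
    length [n!]. *)
Lemma perm_codeP n s : s \in permutations (iota 0 n) ->
  exists x : 'S_n, perm_code x = s.
Proof.
move=> s_perm; suff: s \in map perm_code (enum 'S_n).
  by move=> /mapP[x _ ->]; exists x.
have sub: {subset map perm_code (enum 'S_n) <= permutations (iota 0 n)}.
  move=> _ /mapP[x _ ->]; rewrite mem_permutations; apply: uniq_perm.
  - by rewrite map_inj_uniq ?enum_uniq //; apply: inj_comp val_inj perm_inj.
  - exact: iota_uniq.
  move=> j; rewrite mem_iota /=; apply/mapP/idP => [[i _ ->] | lt_jn]; first exact: ltn_ord.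
  by exists (x^-1 (Ordinal lt_jn)); rewrite ?mem_enum // permKV.
have [//|| _ ->//] := uniq_min_size _ sub.
  by rewrite map_inj_uniq ?enum_uniq //; apply: perm_code_inj.
by rewrite size_permutations ?iota_uniq // size_iota size_map -cardE card_Sn.
Qed.

(** The four blocks are the identity, the double transpositions, the 3-cycles and the 5-cycles.
    Squares are even, and computation finds at least 60 distinct ones, so they exhaust the group. *)
Lemma orders_A5 :
  perm_eq (orders 'Alt_('I_5)) ([:: 1%N] ++ nseq 15 2 ++ nseq 20 3 ++ nseq 24 5).
Proof.
pose sq := undup [seq code_mul s s | s <- permutations (iota 0 5)].
have sub: {subset sq <= map perm_code (enum 'Alt_('I_5))}.
  move=> s; rewrite mem_undup => /mapP[_ /perm_codeP[x <-] ->].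
  rewrite -perm_codeM; apply: map_f; rewrite mem_enum Alt_even.
  by rewrite odd_permM addbb.
have card_A5 : #|'Alt_('I_5)| = 60.
  have := @card_Alt 'I_5; rewrite card_ord => /(_ isT) e.
  by apply/eqP; rewrite -(eqn_pmul2l (ltn0Sn 1)) e.
have eq_sq : perm_eq (map perm_code (enum 'Alt_('I_5))) sq.
  apply: uniq_perm; rewrite ?undup_uniq //.
    by rewrite map_inj_uniq ?enum_uniq //; apply: perm_code_inj.
  move=> s; have [|_ ->//] := uniq_min_size (undup_uniq _) sub.
  by rewrite size_map -cardE card_A5; vm_compute.
rewrite /orders (eq_map (@order_perm_code 5)) (map_comp code_order).
apply: perm_trans (perm_map code_order eq_sq) _.
by vm_compute.
Qed.

Lemma alpha_orders (gT : finGroupType) (G : {group gT}) s :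
  perm_eq (orders G) s -> alpha G = ((cyclic_count s)%:R / (size s)%:R)%R.
Proof.
move=> Gs; rewrite /alpha num_cyclic_orders (perm_cyclic_count _ _ Gs).
by rewrite -(perm_size Gs) size_map -cardE.
Qed.

Lemma card_orders (gT : finGroupType) (G : {group gT}) s :
  perm_eq (orders G) s -> #|G| = size s.
Proof. by move/perm_size <-; rewrite size_map -cardE. Qed.

Lemma setX_setT (T U : finType) : [set: T * U] = setX [set: T] [set: U].
Proof. by apply/setP => u; rewrite !inE. Qed.

Lemma A5_x_Z16_nonsolvable : ~~ solvable A5_x_Z16.
Proof.
have simA5 : simple 'Alt_('I_5) by rewrite simple_Alt5 ?card_ord.
(* A solvable simple group has prime order, and 60 is not prime. Solvability descends from the
   product to its subgroup ['Alt_('I_5)] times 1. *)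
apply/negP => solG; suff /simple_sol_prime/(_ simA5): solvable 'Alt_('I_5).
  by rewrite (card_orders _ _ _ orders_A5).
have := injm_sol (injm_pairg1 {perm 'I_5} 'Z_16) (subsetT 'Alt_('I_5)).
rewrite morphim_pairg1 => <-; apply: solvableS solG.
by rewrite setXS ?sub1G.
Qed.

Definition A5_x_Z16_orders : seq nat :=
  [seq lcmn m n | m <- [:: 1%N] ++ nseq 15 2 ++ nseq 20 3 ++ nseq 24 5,
                  n <- [seq 16 %/ gcdn 16 i | i <- iota 0 16]].

Definition abelian_orders : seq nat :=
  let z n := [seq n %/ gcdn n i | i <- iota 0 n] in
  let x s t := [seq lcmn m n | m <- s, n <- t] in
  x (z 15) (x (x (z 2) (z 2)) (x (z 4) (z 4))).

Lemma orders_A5_x_Z16 : perm_eq (orders A5_x_Z16) A5_x_Z16_orders.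
Proof. by apply: orders_setX orders_A5 _; rewrite -orders_Zp. Qed.

Lemma orders_abelian : perm_eq (orders Z15_x_Z2Z2_x_Z4Z4) abelian_orders.
Proof.
(* The full set is split into nested [setX] so that [orders_setX] applies factor by factor. *)
rewrite /Z15_x_Z2Z2_x_Z4Z4 /= !setX_setT.
by do ![apply: orders_setX]; rewrite -orders_Zp.
Qed.

Theorem mainTheorem3 :
  [/\ #|A5_x_Z16| = 960%N,
      #|Z15_x_Z2Z2_x_Z4Z4| = 960%N,
      alpha A5_x_Z16 = (1 / 6%:R)%R,
      alpha Z15_x_Z2Z2_x_Z4Z4 = (1 / 6%:R)%R
    & ~~ solvable A5_x_Z16]
  /\
  ~ (forall (aT gT : finGroupType) (A : {group aT}) (G : {group gT}),
       abelian A -> #|G| = #|A| -> alpha G = alpha A -> solvable G).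
Proof.
have cG : #|A5_x_Z16| = 960 by rewrite (card_orders _ _ _ orders_A5_x_Z16).
have cA : #|Z15_x_Z2Z2_x_Z4Z4| = 960 by rewrite (card_orders _ _ _ orders_abelian).
have aG : alpha A5_x_Z16 = (1 / 6%:R)%R.
  rewrite (alpha_orders _ _ _ orders_A5_x_Z16).
  (* The ratio becomes 160/960, which is 1/6. *)
  have -> : cyclic_count A5_x_Z16_orders = 160 by vm_compute.
  by have -> : size A5_x_Z16_orders = 960 by vm_compute.
have aA : alpha Z15_x_Z2Z2_x_Z4Z4 = (1 / 6%:R)%R.
  rewrite (alpha_orders _ _ _ orders_abelian).
  have -> : cyclic_count abelian_orders = 160 by vm_compute.
  by have -> : size abelian_orders = 960 by vm_compute.
have nsolG := A5_x_Z16_nonsolvable.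
split=> // all_sol; move/negP: nsolG; apply.
apply: (all_sol _ _ Z15_x_Z2Z2_x_Z4Z4); rewrite ?cG ?cA ?aG ?aA //.
(* Commutativity is checked in each coordinate, where the group law is addition modulo [n]. *)
by apply/centsP => -[x1 [[x2 x3] [x4 x5]]] _ [y1 [[y2 y3] [y4 y5]]] _;
  rewrite /commute /=; congr (_, ((_, _), (_, _))); apply: GRing.addrC.
Qed.
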